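(* Fix constants $\alpha \in (0,1)$ and $\eta > 0$. Let $k = k(p)$ satisfy $k \to \infty$ and $k = o(p)$ as $p \to \infty$, and suppose that the number of tests $n = n(p)$ satisfies $$ n \ge (1+\eta)(1-\alpha)\log_2\binom{p}{k}. $$ Then there exists a (sequence, indexed by $p$, of) non-adaptive test design with $n$ tests and decoder that outputs an estimate $\hat S$ of the defective set $S$ satisfying, as $p \to \infty$, $$ \mathbb{P}\Big[ \max\big\{ |\hat S \setminus S|, |S \setminus \hat S| \big\} \le \alpha k \Big] \to 1 . $$ Moreover, it can be assumed that $\hat S$ has cardinality exactly $k$.
   Context: Probabilistic (noiseless) group testing: there are $p$ items $\{1,\dots,p\}$, and the defective set $S$ is uniformly distributed over the $\binom{p}{k}$ subsets of $\{1,\dots,p\}$ of cardinality $k$. A non-adaptive test design with $n$ tests is a (possibly random) matrix $\mathbf{X} \in \{0,1\}^{n\times p}$, independent of $S$, whose entry $X^{(i)}_j$ equals $1$ iff item $j$ is included in test $i$. The outcomes are $\mathbf{Y} \in \{0,1\}^n$ with $Y^{(i)} = \bigvee_{j \in S} X^{(i)}_j$. A decoder outputs an estimate $\hat S \subseteq \{1,\dots,p\}$ based on $(\mathbf{X},\mathbf{Y})$ (and knowledge of $p,k$), possibly with randomization. Probabilities are over $S$, $\mathbf{X}$ and any randomness of the decoder. *)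

(* Defs.v *)
From HB Require Import structures.
From mathcomp Require Import all_boot all_order all_algebra.
From mathcomp Require Import all_classical all_reals all_analysis.

Set Implicit Arguments.
Unset Strict Implicit.
Unset Printing Implicit Defensive.

Import Order.TTheory GRing.Theory Num.Theory numFieldNormedType.Exports.

Local Open Scope ring_scope.

Record fdist (R : realType) (T : finType) := FDist {
  fdist_pmf :> T -> R ;
  fdist_ge0 : forall x, 0 <= fdist_pmf x ;
  fdist_sum1 : \sum_x fdist_pmf x = 1 }.

Definition log2 (R : realType) (x : R) : R := ln x / ln 2.

(* Row i of a test matrix is test i: [X i j] holds iff item j is included. *)
Definition outcome (n p : nat) (X : 'M[bool]_(n, p)) (S : {set 'I_p}) :
    'cV[bool]_n :=
  \col_i [exists j in S, X i j].

(* The law of the test matrix cannot mention the defective set, which encodes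
   the independence of X and S. *)
Definition design (R : realType) (n p : nat) := fdist R 'M[bool]_(n, p).

(* A randomized decoder is a Markov kernel: given (X, Y), it is the conditional
   law of the estimate.  Its own randomness is thus independent of S given
   (X, Y). *)
Definition decoder (R : realType) (n p : nat) :=
  'M[bool]_(n, p) -> 'cV[bool]_n -> fdist R {set 'I_p}.

(* Probability of the event [E S Shat], with S uniform over the k-subsets of
   the p items, X drawn from D, and Shat drawn from [dec X (outcome X S)].  It
   is a genuine probability only for k <= p. *)
Definition gt_prob (R : realType) (n p k : nat) (D : design R n p)
    (dec : decoder R n p) (E : {set 'I_p} -> {set 'I_p} -> bool) : R :=
  \sum_(S : {set 'I_p} | #|S| == k) ('C(p, k)%:R)^-1 *
    \sum_(X : 'M[bool]_(n, p)) D X *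
      \sum_(A : {set 'I_p} | E S A) dec X (outcome X S) A.

(* Main.v *)
(** Every item is first kept with probability [m], slightly more than
    [1 - alpha], and the dropped items are never tested.  By Chebyshev the number
    of kept defectives is close to [m k], so that missing all the dropped ones
    costs a little less than the allowed [alpha k] errors.  The kept items are
    tested by independent Bernoulli rows for which a set of size [K ~ m k] is
    missed with probability [1/2].  For sets [U], [V] of size at most [K], with
    [r = |V \ U|] and [s = |U \ V|], a row then has equal outcomes with probability
    at most [(2 ^ (- r / K) + 2 ^ (- s / K)) / 2].  With
    [n >= (1 + eta) (1 - alpha) k log2 (p / k)] rows, a given [V] is confused with
    [U] with probability roughly [(k / p) ^ ((1 + eta / 2) r)], and
    [\sum_V (k / p) ^ r <= exp (2 k)] makes the union bound over the [V] with
    [r] of order [k] tend to 0.  Averaging fixes the mask and the rows. *)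

Require Import Defs.
From mathcomp Require Import all_boot all_order all_algebra.
From mathcomp Require Import all_classical all_reals all_analysis.
From mathcomp Require Import ring lra.
Import Order.TTheory GRing.Theory Num.Theory numFieldNormedType.Exports.
Local Open Scope ring_scope.

Set Implicit Arguments.
Unset Strict Implicit.

(** * Bernoulli random subsets and their collisions *)

Definition bern (R : realType) (I : finType) (a : R) (A : {set I}) : R :=
  \prod_j (if j \in A then a else 1 - a).

Definition hits (I : finType) (A W : {set I}) : bool := ~~ [disjoint A & W].

Lemma bern_ge0 (R : realType) (I : finType) (a : R) (A : {set I}) :
  0 <= a <= 1 -> 0 <= bern a A.
Proof.
by move=> /andP[a0 a1]; apply: prodr_ge0 => j _; case: ifP; rewrite ?subr_ge0.
Qed.

Lemma bern_sum1 (R : realType) (I : finType) (a : R) :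
  \sum_(A : {set I}) bern a A = 1.
Proof.
rewrite -(bigA_distr _ _ (fun=> a) (fun=> 1 - a)).
by rewrite big1 // => j _; rewrite /= addrC subrK.
Qed.

(** Avoiding [W] amounts to giving weight 0 to the choice of an item of [W]; the sum then factors
    over the items. *)
Lemma bern_avoid (R : realType) (I : finType) (a : R) (W : {set I}) :
  \sum_(A : {set I}) bern a A * [disjoint A & W]%:R = (1 - a) ^+ #|W|.
Proof.
transitivity (\sum_(A : {set I})
    \prod_j (if j \in A then (if j \in W then 0 else a) else 1 - a)).
  apply: eq_bigr => A _; case: (boolP [disjoint A & W]) => [dAW|].
    rewrite mulr1; apply: eq_bigr => j _; case: ifP => // jA.
    by rewrite (disjointFr dAW jA).
  rewrite -setI_eq0 => /set0Pn[j /setIP[jA jW]].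
  by rewrite mulr0 (bigD1 j) //= jA jW mul0r.
rewrite -(bigA_distr _ _ (fun j => if j \in W then 0 else a) (fun=> 1 - a)).
rewrite (bigID (mem W)) /= [X in _ * X]big1; last first.
  by move=> j /negbTE ->; rewrite /= addrC subrK.
rewrite mulr1 -prodr_const; apply: eq_bigr => j jW.
by rewrite jW add0r.
Qed.

(** Memberships are independent: after factoring over the items, the factor at [i] is
    [a (1 - a) + (1 - a) (0 - a) = 0]. *)
Lemma bern_cov (R : realType) (I : finType) (a : R) (i j : I) : i != j ->
  \sum_(A : {set I}) bern a A * (((i \in A)%:R - a) * ((j \in A)%:R - a)) = 0.
Proof.
move=> ij; pose c (b : bool) l : R :=
  (if b then a else 1 - a) * (if l == i then b%:R - a else 1)
    * (if l == j then b%:R - a else 1).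
transitivity (\sum_(A : {set I})
    \prod_l (if l \in A then c true l else c false l)).
  apply: eq_bigr => A _.
  have -> : (i \in A)%:R - a = \prod_l (if l == i then (l \in A)%:R - a else 1).
    by rewrite -big_mkcond big_pred1_eq.
  have -> : (j \in A)%:R - a = \prod_l (if l == j then (l \in A)%:R - a else 1).
    by rewrite -big_mkcond big_pred1_eq.
  rewrite mulrA -!big_split /=; apply: eq_bigr => l _.
  by rewrite /c; case: (l \in A).
rewrite -bigA_distr (bigD1 i) //= /c eqxx (negbTE ij) /=.
by rewrite [X in X * _](_ : _ = 0) ?mul0r //; ring.
Qed.

(* Chebyshev's inequality; the diagonal covariances are bounded by 1. *)
Lemma bern_concentration (R : realType) (I : finType) (a t : R) (S : {set I}) :
  0 <= a <= 1 -> 0 < t ->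
  \sum_(A : {set I}) bern a A * (t < `|#|S :&: A|%:R - a * #|S|%:R|)%R%:R
    <= #|S|%:R / t ^+ 2.
Proof.
move=> a01 t0.
have t20 : 0 < t ^+ 2 by apply: exprn_gt0.
rewrite ler_pdivlMr // mulr_suml.
have cardE (A : {set I}) :
    #|S :&: A|%:R - a * #|S|%:R = \sum_(j in S) ((j \in A)%:R - a).
  rewrite sumrB sumr_const mulr_natr; congr (_ - _).
  rewrite -sum1_card natr_sum big_mkcond [RHS]big_mkcond /=.
  by apply: eq_bigr => j _; rewrite inE; case: (j \in S); case: (j \in A).
apply: (@le_trans _ _ (\sum_(A : {set I}) bern a A *
    (\sum_(j in S) ((j \in A)%:R - a)) ^+ 2)).
  apply: ler_sum => A _; rewrite -mulrA ler_wpM2l ?bern_ge0 // -cardE.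
  case: ltP => [lt_t|_]; last by rewrite mul0r sqr_ge0.
  rewrite mul1r -[leRHS]real_normK ?num_real //.
  by rewrite ler_pXn2r ?nnegrE // ltW.
have -> : \sum_(A : {set I}) bern a A * (\sum_(j in S) ((j \in A)%:R - a)) ^+ 2
    = \sum_(i in S) \sum_(j in S) \sum_(A : {set I})
        bern a A * (((i \in A)%:R - a) * ((j \in A)%:R - a)).
  under eq_bigr => A _.
    rewrite expr2 big_distrlr /= mulr_sumr.
    under eq_bigr => i _ do rewrite mulr_sumr.
    over.
  rewrite exchange_big; apply: eq_bigr => i _.
  by rewrite exchange_big.
rewrite -sum1_card natr_sum; apply: ler_sum => i iS.
rewrite (bigD1 i) //= [X in _ + X]big1 ?addr0; last first.
  by move=> j /andP[_ ji]; rewrite bern_cov // eq_sym.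
rewrite -[leRHS](bern_sum1 I a); apply: ler_sum => A _.
rewrite ler_piMr ?bern_ge0 // -expr2.
move/andP: a01 => [a0 a1]; case: (i \in A).
  by rewrite mulr1n exprn_ile1 ?subr_ge0 // gerBl.
by rewrite mulr0n sub0r sqrrN exprn_ile1.
Qed.

(** With [r = |V \ U|] and [s = |U \ V|], inclusion-exclusion gives the agreement probability [1 - q
    ^ |U| (1 - q ^ r) - q ^ |V| (1 - q ^ s)]; the lower bounds [1/2] then bound it by the mean of
    [q ^ r] and [q ^ s]. *)
Lemma bern_agree_le (R : realType) (I : finType) (q c : R) (U V : {set I}) :
  2^-1 <= q ^+ #|U| -> 2^-1 <= q ^+ #|V| ->
  q ^+ #|V :\: U| <= c -> q ^+ #|U :\: V| <= c -> 0 <= q <= 1 ->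
  \sum_(A : {set I}) bern (1 - q) A * (hits A U == hits A V)%:R <= c.
Proof.
move=> qU qV cVU cUV /andP[q0 q1].
have -> : \sum_(A : {set I}) bern (1 - q) A * (hits A U == hits A V)%:R =
    1 - q ^+ #|U| - q ^+ #|V| + 2 * q ^+ #|U :|: V|.
  transitivity (\sum_(A : {set I}) (bern (1 - q) A
      - bern (1 - q) A * [disjoint A & U]%:R
      - bern (1 - q) A * [disjoint A & V]%:R
      + 2 * (bern (1 - q) A * [disjoint A & U :|: V]%:R))).
    apply: eq_bigr => A _; rewrite /hits.
    have -> : [disjoint A & U :|: V] = [disjoint A & U] && [disjoint A & V].
      by rewrite -!setI_eq0 finset.setIUr finset.setU_eq0.
    by case: [disjoint A & U]; case: [disjoint A & V] => /=; ring.
  rewrite big_split /= -mulr_sumr !sumrB bern_sum1 !bern_avoid.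
  by have -> : 1 - (1 - q) = q by ring.
have UE : q ^+ #|U :|: V| = q ^+ #|U| * q ^+ #|V :\: U|.
  by rewrite -exprD cardsU cardsD finset.setIC addnBA // subset_leq_card // finset.subsetIl.
have VE : q ^+ #|U :|: V| = q ^+ #|V| * q ^+ #|U :\: V|.
  rewrite finset.setUC -exprD cardsU cardsD finset.setIC addnBA //.
  by rewrite subset_leq_card // finset.subsetIl.
have e1 : q ^+ #|V :\: U| <= 1 by apply: exprn_ile1.
have e2 : q ^+ #|U :\: V| <= 1 by apply: exprn_ile1.
have -> : 1 - q ^+ #|U| - q ^+ #|V| + 2 * q ^+ #|U :|: V| =
    1 - q ^+ #|U| * (1 - q ^+ #|V :\: U|) - q ^+ #|V| * (1 - q ^+ #|U :\: V|).
  by rewrite mulr2n mulrDl !mul1r {1}UE VE; ring.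
by nra.
Qed.

(** Union bound over [V]; the rows are independent, so agreement on all of them has an [n]-th power
    as its probability. *)
Lemma bern_collision_le (R : realType) (I : finType) (n : nat) (a : R)
    (U : {set I}) (P : pred {set I}) (c : {set I} -> R) :
  0 <= a <= 1 ->
  (forall V, P V ->
     \sum_(A : {set I}) bern a A * (hits A U == hits A V)%:R <= c V) ->
  \sum_(B : {ffun 'I_n -> {set I}}) (\prod_i bern a (B i)) *
      [exists V, P V && [forall i, hits (B i) U == hits (B i) V]]%:R
    <= \sum_(V | P V) c V ^+ n.
Proof.
move=> a01 Pc.
apply: (@le_trans _ _ (\sum_(V | P V) \sum_(B : {ffun 'I_n -> {set I}})
    \prod_i (bern a (B i) * (hits (B i) U == hits (B i) V)%:R))).
  rewrite exchange_big /=; apply: ler_sum => B _.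
  have terms_ge0 V :
      0 <= \prod_i (bern a (B i) * (hits (B i) U == hits (B i) V)%:R).
    by apply: prodr_ge0 => i _; rewrite mulr_ge0 ?bern_ge0.
  case: existsP => [[V /andP[PV /forallP agree]]|_]; last first.
    by rewrite mulr0 sumr_ge0.
  rewrite (bigD1 V) //= mulr1 ler_wpDr ?sumr_ge0 //.
  by apply: ler_prod => i _; rewrite agree mulr1 bern_ge0 /=.
apply: ler_sum => V PV.
rewrite -(bigA_distr_bigA
  (fun (_ : 'I_n) A => bern a A * (hits A U == hits A V)%:R)) /=.
rewrite prodr_const card_ord lerXn2r ?nnegrE ?Pc //.
  by apply: sumr_ge0 => A _; rewrite mulr_ge0 ?bern_ge0.
apply: le_trans (Pc _ PV).
by apply: sumr_ge0 => A _; rewrite mulr_ge0 ?bern_ge0.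
Qed.

(** * Counting bounds *)

(** The sum factors into [2] for each item of [U] and [1 + y] for each other item, and
    [1 + x <= expR x]. *)
Lemma sum_exp_cardD_le (R : realType) (I : finType) (y : R) (U : {set I}) :
  0 <= y ->
  \sum_(V : {set I}) y ^+ #|V :\: U| <= expR (#|U|%:R + y * #|I|%:R).
Proof.
move=> y0; pose f j := if j \in U then 1 else y.
have f0 j : 0 <= f j by rewrite /f; case: ifP.
have -> : \sum_(V : {set I}) y ^+ #|V :\: U| = \prod_j (f j + 1).
  rewrite (bigA_distr _ _ f (fun=> 1)); apply: eq_bigr => V _.
  rewrite -prodr_const big_mkcond; apply: eq_bigr => j _; rewrite inE /f.
  by case: (j \in U); case: (j \in V).
apply: (@le_trans _ _ (expR (\sum_j f j))).
  rewrite expR_sum; apply: ler_prod => j _.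
  by rewrite addr_ge0 //= addrC expR_ge1Dx.
rewrite ler_expR (bigID (mem U)) /= lerD //.
  by rewrite -sum1_card natr_sum; apply: ler_sum => j jU; rewrite /f jU.
apply: (@le_trans _ _ (\sum_(j : I) y)); last by rewrite sumr_const mulr_natr.
rewrite big_mkcond /=; apply: ler_sum => j _; rewrite /f.
by case: (j \in U).
Qed.

Lemma expr_divn_le_bin (R : realType) (p k : nat) : (k <= p)%N ->
  (p%:R / k%:R) ^+ k <= 'C(p, k)%:R :> R.
Proof.
elim: k p => [|k IHk] [|p] //; rewrite ?expr0 ?bin0 // ltnS => kp.
have k10 : 0 < k.+1%:R :> R by rewrite ltr0n.
rewrite -(ler_pM2l k10) -natrM -mul_bin_diag natrM exprS mulrA.
rewrite [k.+1%:R * _]mulrC divfK ?gt_eqF // ler_wpM2l //.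
(* What remains is [(p + 1) / (k + 1) <= p / k], which follows from [k <= p]; the exponent [k = 0]
   is treated apart because of the division by [k]. *)
apply: le_trans (IHk p kp).
case: k kp k10 {IHk} => [|k] kp k10; first by rewrite !expr0.
rewrite lerXn2r ?nnegrE ?divr_ge0 // ler_pdivrMr // mulrAC ler_pdivlMr ?ltr0n //.
by rewrite -!natrM ler_nat mulSn [leqRHS]mulnS leq_add2r.
Qed.

Lemma ex_superset_card (I : finType) (V : {set I}) (k : nat) :
  (#|V| <= k <= #|I|)%N -> exists2 A : {set I}, V \subset A & #|A| = k.
Proof.
move=> /andP[]; elim: k => [|k IHk].
  by rewrite leqn0 => /eqP V0 _; exists V.
rewrite leq_eqVlt => /predU1P[<- _|/IHk {}IHk kI]; first by exists V.
have [A VA cA] := IHk (ltnW kI).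
have /card_gt0P[x] : (0 < #|~: A|)%N.
  by rewrite cardsCs finset.setCK cA subn_gt0.
rewrite inE => xA; exists (x |: A); last by rewrite cardsU1 xA cA.
by apply: (fintype.subset_trans VA); apply: finset.subsetUr.
Qed.

(** * Confusion between candidates of typical size *)

(** [m * kr] is the expected number of kept defectives, and [w] is the tolerance relative to [kr],
    the real number [k]. *)
Definition in_window (R : realType) (I : finType) (m w kr : R) (V : {set I}) :=
  `|#|V|%:R - m * kr| <= w * kr.

(* Distinct candidates of the window have set differences of nearly equal size:
   this is what makes [(q ^ r + q ^ s) / 2] as good as [q ^ r]. *)
Lemma window_collision_le (R : realType) (I : finType) (n k : nat)
    (m w tau theta eta : R) (U : {set I}) :
  (0 < k <= #|I|)%N -> 0 < w -> 0 < m -> m + w <= 1 ->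
  0 < theta <= 1 -> 4 * w <= theta * tau -> 0 < eta ->
  (1 + eta / 2) * (m + w) * k%:R * ln (#|I|%:R / k%:R)
    <= (1 - theta) * n%:R * ln 2 ->
  12 <= eta * tau * ln (#|I|%:R / k%:R) ->
  in_window m w k%:R U ->
  \sum_(B : {ffun 'I_n -> {set I}})
      (\prod_i bern (1 - expR (- (ln 2 / ((m + w) * k%:R)))) (B i)) *
      [exists V, [&& in_window m w k%:R V, (tau * k%:R < #|U :\: V|%:R)%R &
        [forall i, hits (B i) U == hits (B i) V]]]%:R
    <= expR (- k%:R).
Proof.
move=> /andP[k0 kI] w0 m0 mw1 /andP[th0 th1] w4 eta0 hn hL winU.
set L := ln _ in hn hL.
have kr0 : 0 < k%:R :> R by rewrite ltr0n.
have I0 : 0 < #|I|%:R :> R by rewrite ltr0n (leq_trans k0).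
set K := (m + w) * k%:R; set q := expR _.
have K0 : 0 < K by rewrite mulr_gt0 // addr_gt0.
have ln20 : 0 < ln 2 :> R by rewrite ln_gt0 // ltr1n.
have q01 : 0 <= q <= 1.
  by rewrite expR_ge0 /= -expR0 ler_expR oppr_le0 divr_ge0 // ltW.
have q01' : 0 <= 1 - q <= 1 by case/andP: q01 => ? ?; lra.
have qX c : q ^+ c = expR (- (c%:R * ln 2 / K)).
  by rewrite -expRM_natl mulrN mulrA.
(* [q] solves [q ^ K = 1/2], and sets of the window have at most [K] items. *)
have half V : in_window m w k%:R V -> 2^-1 <= q ^+ #|V|.
  rewrite /in_window ler_norml => /andP[_ vK].
  rewrite -{1}[2]lnK ?posrE // -expRN qX ler_expR lerN2 ler_pdivrMr //.
  by rewrite mulrC ler_pM2l // /K; lra.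
(* Write [r = |V \ U|] and [s = |U \ V|]. They differ by at most [2 w k <= theta tau k / 2], so
   [s > tau k] forces [r >= tau k / 2], and the difference is then at most [theta r]. *)
have sizes V : in_window m w k%:R V -> tau * k%:R < #|U :\: V|%:R ->
   [/\ (1 - theta) * #|V :\: U|%:R <= #|U :\: V|%:R &
       tau * k%:R <= 2 * #|V :\: U|%:R].
  move: winU; rewrite /in_window !ler_norml => /andP[u1 u2] /andP[v1 v2] s0.
  have eqn : #|U :\: V|%:R + #|V|%:R = #|V :\: U|%:R + #|U|%:R :> R.
    rewrite -!natrD; congr (_%:R).
    by rewrite -(cardsID U V) -(cardsID V U) finset.setIC; ring.
  have w4k : 4 * (w * k%:R) <= theta * (tau * k%:R).
    by rewrite !mulrA ler_pM2r.
  have tau0 : 0 < tau * k%:R.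
    by rewrite mulr_gt0 // -(pmulr_rgt0 _ th0); lra.
  have thtau : theta * (tau * k%:R) <= tau * k%:R.
    by rewrite ler_piMl // ltW.
  have r2 : tau * k%:R <= 2 * #|V :\: U|%:R by lra.
  split=> //.
  have : theta * (tau * k%:R) <= theta * (2 * #|V :\: U|%:R).
    by rewrite ler_pM2l.
  by lra.
pose c (V : {set I}) := expR (- ((1 - theta) * #|V :\: U|%:R * ln 2 / K)).
pose P (V : {set I}) :=
  in_window m w k%:R V && (tau * k%:R < #|U :\: V|%:R)%R.
have agree V : P V ->
    \sum_(A : {set I}) bern (1 - q) A * (hits A U == hits A V)%:R <= c V.
  case/andP=> winV sV; have [rs _] := sizes V winV sV.
  apply: bern_agree_le; rewrite ?half //.
    rewrite qX ler_expR lerN2 ler_pM2r ?invr_gt0 // ler_pM2r //.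
    by rewrite ler_piMl // gerBl ltW.
  by rewrite qX ler_expR lerN2 ler_pM2r ?invr_gt0 // ler_pM2r.
apply: (@le_trans _ _ (\sum_(V | P V) c V ^+ n)).
  apply: le_trans (bern_collision_le n q01' agree).
  apply: ler_sum => B _.
  rewrite ler_wpM2l ?prodr_ge0 // => [i _|]; first exact: bern_ge0.
  rewrite ler_nat; case: existsP => // -[V hV]; rewrite lt0b; apply/existsP.
  by exists V; rewrite /P -andbA.
have LE : expR (- L) = k%:R / #|I|%:R.
  by rewrite expRN lnK ?invf_div // posrE divr_gt0.
have L0 : 0 <= L.
  by rewrite ln_ge0 // ler_pdivlMr // mul1r ler_nat.
(* The exponent [(1 + eta / 2) r L] is split: [r L] becomes [(k / p) ^ r], to be summed over [V],
   and [r >= tau k / 2] bounds the rest below uniformly in [V]. *)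
apply: (@le_trans _ _ (\sum_(V : {set I})
    expR (- (eta * tau * L / 4 * k%:R)) * (k%:R / #|I|%:R) ^+ #|V :\: U|)).
  rewrite big_mkcond /=; apply: ler_sum => V _; case: ifP => PV; last first.
    by rewrite mulr_ge0 ?expR_ge0 // exprn_ge0 // divr_ge0.
  case/andP: PV => winV sV; have [_ r2] := sizes V winV sV.
  rewrite -LE -!expRM_natl -expRD ler_expR !mulrN -opprD lerN2.
  set r := #|V :\: U|%:R in r2 *.
  have r0 : 0 <= r by [].
  have -> : n%:R * ((1 - theta) * r * ln 2 / K) =
      r * ((1 - theta) * n%:R * ln 2) / K by ring.
  apply: (@le_trans _ _ (r * ((1 + eta / 2) * L))).
    have : eta * L * (tau * k%:R) <= eta * L * (2 * r).
      by rewrite ler_wpM2l // mulr_ge0 // ltW.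
    by lra.
  rewrite -mulrA ler_wpM2l // ler_pdivlMr //.
  by apply: le_trans hn; rewrite /K le_eqVlt; apply/orP; left; apply/eqP; ring.
rewrite -mulr_sumr.
have y0 : 0 <= k%:R / #|I|%:R :> R by rewrite divr_ge0.
apply: le_trans (ler_wpM2l (expR_ge0 _) (sum_exp_cardD_le U y0)) _.
rewrite -expRD ler_expR divfK ?gt_eqF //.
have uk : #|U|%:R <= k%:R :> R.
  move: winU; rewrite /in_window ler_norml => /andP[_ u2].
  have : (m + w) * k%:R <= 1 * k%:R by rewrite ler_pM2r.
  by lra.
(* The constant 12 yields a factor [expR (- 3 k)], against at most [expR (2 k)] from the sum over
   [V]. *)
have : 12 * k%:R <= eta * tau * L * k%:R by rewrite ler_pM2r.
by lra.
Qed.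

(** * Averaging, and deterministic designs and decoders *)

Lemma ex_le_mean (R : realType) (J : finType) (mu f : J -> R) (c : R) :
  (forall x, 0 <= mu x) -> \sum_x mu x = 1 -> \sum_x mu x * f x <= c ->
  exists x, f x <= c.
Proof.
move=> mu0 mu1 mean_le; apply: contrapT => /forallNP all_gt.
have {}all_gt x : c < f x by rewrite ltNge; apply/negP; exact: all_gt.
suff : c < c by rewrite ltxx.
apply: lt_le_trans mean_le.
(* A point of positive mass, which exists as the total is not 0, makes the comparison of means
   strict. *)
have [x mux] : exists x, 0 < mu x.
  apply: contrapT => /forallNP mu_le0.
  suff : (0 : R) = 1 by move/eqP; rewrite eq_sym oner_eq0.
  rewrite -mu1 big1 // => x _; apply/eqP; rewrite eq_le mu0 andbT leNgt.
  by apply/negP; exact: mu_le0.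
rewrite -[ltLHS]mul1r -mu1 mulr_suml (bigD1 x) //= [ltRHS](bigD1 x) //=.
rewrite ltr_leD ?ltr_pM2l //; apply: ler_sum => y _.
by rewrite ler_wpM2l // ltW.
Qed.

Lemma dirac_sum (R : realType) (J : finType) (x : J) (F : J -> R) :
  \sum_y (y == x)%:R * F y = F x.
Proof.
rewrite (bigD1 x) //= eqxx mul1r big1 ?addr0 // => y /negbTE ->.
by rewrite mul0r.
Qed.

Lemma dirac_sum1 (R : realType) (J : finType) (x : J) :
  \sum_y (y == x)%:R = 1 :> R.
Proof.
by under eq_bigr => y _ do rewrite -[_%:R]mulr1; rewrite dirac_sum.
Qed.

Definition dirac_fdist (R : realType) (J : finType) (x : J) : fdist R J :=
  @FDist R J (fun y => (y == x)%:R) (fun=> ler0n _ _) (dirac_sum1 R x).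

Lemma gt_prob_dirac (R : realType) (n p k : nat) (X : 'M[bool]_(n, p))
    (f : 'M[bool]_(n, p) -> 'cV[bool]_n -> {set 'I_p})
    (E : {set 'I_p} -> {set 'I_p} -> bool) :
  gt_prob k (dirac_fdist R X) (fun X Y => dirac_fdist R (f X Y)) E =
    \sum_(S : {set 'I_p} | #|S| == k)
      ('C(p, k)%:R)^-1 * (E S (f X (outcome X S)))%:R.
Proof.
apply: eq_bigr => S _; congr (_ * _); rewrite dirac_sum.
rewrite big_mkcond /=.
rewrite -(dirac_sum (f X (outcome X S)) (fun A => (E S A)%:R)).
by apply: eq_bigr => A _; case: (E S A); rewrite ?mulr1 ?mulr0.
Qed.

Lemma fdist_sub_le1 (R : realType) (J : finType) (d : fdist R J) (P : pred J) :
  \sum_(x | P x) d x <= 1.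
Proof.
rewrite -(fdist_sum1 d) big_mkcond /=; apply: ler_sum => x _.
by case: ifP; rewrite ?fdist_ge0.
Qed.

Lemma sum_ksets_const (R : realType) (p k : nat) (c : R) :
  \sum_(S : {set 'I_p} | #|S| == k) c = 'C(p, k)%:R * c.
Proof.
rewrite -[in RHS](card_ord p) -card_draws mulr_natl -sumr_const.
by apply: eq_bigl => S; rewrite inE.
Qed.

(** Leaves only a lower bound on the success probability to be proved for the limit. *)
Lemma gt_prob_le1 (R : realType) (n p k : nat) (D : design R n p)
    (dec : decoder R n p) (E : {set 'I_p} -> {set 'I_p} -> bool) :
  (k <= p)%N -> gt_prob k D dec E <= 1.
Proof.
move=> kp; have C0 : 'C(p, k)%:R != 0 :> R by rewrite pnatr_eq0 -lt0n bin_gt0.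
rewrite -[leRHS](mulfV C0) -sum_ksets_const; apply: ler_sum => S _.
rewrite ler_piMr ?invr_ge0 // -(fdist_sum1 D); apply: ler_sum => X _.
by rewrite ler_piMr ?fdist_ge0 // fdist_sub_le1.
Qed.

(** * The masked design and its decoder *)

Definition masked_design (n p : nat) (T : {set 'I_p})
    (B : {ffun 'I_n -> {set 'I_p}}) : 'M[bool]_(n, p) :=
  \matrix_(i, j) ((j \in B i) && (j \in T)).

Lemma outcome_masked (n p : nat) (T : {set 'I_p})
    (B : {ffun 'I_n -> {set 'I_p}}) (S : {set 'I_p}) (i : 'I_n) :
  outcome (masked_design T B) S i ord0 = hits (B i) (S :&: T).
Proof.
rewrite mxE /hits -setI_eq0; apply/existsP/finset.set0Pn => [[j]|[j]].
  rewrite mxE => /and3P[jS jB jT]; exists j.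
  by rewrite !inE jB jS jT.
by rewrite !inE => /and3P[jB jS jT]; exists j; rewrite mxE jS jB jT.
Qed.

(* Picks a [k]-set containing some consistent candidate [V]; [A0] is returned when
   there is none. *)
Definition mask_decoder (R : realType) (n p k : nat) (m w : R) (A0 T : {set 'I_p})
    (X : 'M[bool]_(n, p)) (Y : 'cV[bool]_n) : {set 'I_p} :=
  odflt A0 [pick A : {set 'I_p} | (#|A| == k) &&
    [exists V : {set 'I_p}, [&& V \subset A, V \subset T,
      in_window m w k%:R V & outcome X V == Y]]].

(** Since [A] and [S] have equal size, both errors are equal. As [V] lies in [A], each missed
    defective is either dropped by the mask, at most [(1 - m + w) k] of them by the window, or in
    [U \ V], at most [tau k] of them since no far candidate collides with [U]. *)
Lemma mask_decoderP (R : realType) (n p k : nat) (alpha m w tau : R)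
    (A0 T S A : {set 'I_p}) (B : {ffun 'I_n -> {set 'I_p}}) :
  (k <= p)%N -> #|S| = k -> m + w <= 1 -> 1 - m + w + tau <= alpha ->
  in_window m w k%:R (S :&: T) ->
  ~~ [exists V, [&& in_window m w k%:R V,
        (tau * k%:R < #|(S :&: T) :\: V|%:R)%R &
        [forall i, hits (B i) (S :&: T) == hits (B i) V]]] ->
  A = mask_decoder k m w A0 T (masked_design T B)
        (outcome (masked_design T B) S) ->
  (maxn #|A :\: S| #|S :\: A|)%:R <= alpha * k%:R.
Proof.
move=> kp cS mw1 halpha winU noV AE.
set X := masked_design T B in AE; set U := S :&: T in winU noV.
have [cA [V [VA VT winV eqV]]] : #|A| = k /\ exists V : {set 'I_p},
    [/\ V \subset A, V \subset T, in_window m w k%:R V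
       & outcome X V = outcome X S].
  rewrite AE /mask_decoder; case: pickP => [A'|none].
    move=> /andP[/eqP cA' /existsP[V /and4P[? ? ? /eqP ?]]].
    by split=> //; exists V.
  (* The default [A0] is not reached: any [k]-set containing [U] is eligible, with [U] itself as the
     consistent candidate. *)
  have [|A' UA' cA'] := @ex_superset_card 'I_p U k.
    by rewrite card_ord kp andbT -cS subset_leq_card // finset.subsetIl.
  have /negP[] := negbT (none A'); rewrite cA' eqxx /=; apply/existsP.
  exists U; rewrite UA' winU finset.subsetIr /=; apply/eqP/colP => i.
  by rewrite !outcome_masked -finset.setIA finset.setIid.
(* As [V] lies inside the mask, equality of outcomes says exactly that the rows confuse [V] with
   [U]. *)
have VTE : V :&: T = V by apply/finset.setIidPl.
have sV : #|U :\: V|%:R <= tau * k%:R.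
  rewrite leNgt; apply: contra noV => sV; apply/existsP; exists V.
  rewrite winV sV /=; apply/forallP => i; apply/eqP.
  by rewrite -outcome_masked -/X -eqV outcome_masked VTE.
have cAS : #|A :\: S| = #|S :\: A| by rewrite !cardsD cA cS finset.setIC.
rewrite cAS maxnn.
have : (#|S :\: A| <= #|S :\: U| + #|U :\: V|)%N.
  apply: leq_trans (leq_card_setU _ _); apply: subset_leq_card.
  apply/fintype.subsetP => j; rewrite !inE => /andP[jA ->].
  have -> : j \notin V by apply: contra jA; apply: (fintype.subsetP VA).
  by case: (j \in T).
have -> : (#|S :\: U| = k - #|U|)%N.
  by rewrite cardsD cS /U finset.setIA finset.setIid.
rewrite -(ler_nat R) natrD natrB; last first.
  by rewrite -cS subset_leq_card // finset.subsetIl.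
move: winU; rewrite /in_window ler_norml => /andP[u1 _] le_card.
have : (1 - m + w + tau) * k%:R <= alpha * k%:R by rewrite ler_wpM2r.
by lra.
Qed.

(** For each fixed [S], the mask fails with probability at most [1 / (w ^ 2 k)] by Chebyshev, and
    the rows with probability at most [expR (- k) <= 1 / k]. *)
Lemma ex_mask_design (R : realType) (n p k : nat)
    (alpha m w tau theta eta : R) :
  (0 < k <= p)%N -> 0 < w -> 0 < m -> m + w <= 1 ->
  0 < theta <= 1 -> 4 * w <= theta * tau -> 0 < eta ->
  1 - m + w + tau <= alpha ->
  (1 + eta / 2) * (m + w) * k%:R * ln (p%:R / k%:R)
    <= (1 - theta) * n%:R * ln 2 ->
  12 <= eta * tau * ln (p%:R / k%:R) ->
  exists (D : design R n p) (dec : decoder R n p),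
    (forall X Y A, 0 < dec X Y A -> #|A| = k) /\
    1 - ((w ^+ 2)^-1 + 1) / k%:R <=
      gt_prob k D dec
        (fun S A => (maxn #|A :\: S| #|S :\: A|)%:R <= alpha * k%:R).
Proof.
move=> /andP[k0 kp] w0 m0 mw1 th w4 eta0 halpha hn hL.
have kr0 : 0 < k%:R :> R by rewrite ltr0n.
set q := expR (- (ln 2 / ((m + w) * k%:R))).
have q01 : 0 <= 1 - q <= 1.
  rewrite subr_ge0 gerBl expR_ge0 andbT -expR0 ler_expR oppr_le0 divr_ge0 //.
    by rewrite ln_ge0 // ler1n.
  by rewrite mulr_ge0 // addr_ge0 // ltW.
have m01 : 0 <= m <= 1 by lra.
set delta := _ / k%:R.
pose coll (U : {set 'I_p}) (B : {ffun 'I_n -> {set 'I_p}}) :=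
  [exists V, [&& in_window m w k%:R V, (tau * k%:R < #|U :\: V|%:R)%R &
    [forall i, hits (B i) U == hits (B i) V]]].
pose bad (x : {set 'I_p} * {ffun 'I_n -> {set 'I_p}}) (S : {set 'I_p}) :=
  ~~ in_window m w k%:R (S :&: x.1)
    || in_window m w k%:R (S :&: x.1) && coll (S :&: x.1) x.2.
pose muB (B : {ffun 'I_n -> {set 'I_p}}) := \prod_i bern (1 - q) (B i).
have muB0 B : 0 <= muB B by apply: prodr_ge0 => i _; apply: bern_ge0.
have muB1 : \sum_B muB B = 1.
  rewrite -(bigA_distr_bigA (fun (_ : 'I_n) A => bern (1 - q) A)) /=.
  by rewrite big1 // => i _; rewrite bern_sum1.
pose mu (x : {set 'I_p} * {ffun 'I_n -> {set 'I_p}}) := bern m x.1 * muB x.2.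
have mu0 x : 0 <= mu x by rewrite mulr_ge0 ?bern_ge0.
have mu1 : \sum_x mu x = 1.
  rewrite /mu -(pair_bigA _ (fun T B => bern m T * muB B)) /=.
  by under eq_bigr do rewrite -mulr_sumr muB1 mulr1; rewrite bern_sum1.
have bad_le (S : {set 'I_p}) : #|S| == k -> \sum_x mu x * (bad x S)%:R <= delta.
  move=> /eqP cS.
  rewrite /mu -(pair_bigA _ (fun T B => bern m T * muB B * (bad (T, B) S)%:R)).
  apply: (@le_trans _ _ (\sum_T (bern m T *
      (w * k%:R < `|#|S :&: T|%:R - m * #|S|%:R|)%R%:R
      + bern m T * expR (- k%:R)))).
    apply: ler_sum => T _; under eq_bigr do rewrite -mulrA.
    rewrite -mulr_sumr -mulrDr ler_wpM2l ?bern_ge0 // /bad /=.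
    rewrite ltNge cS -/(in_window m w k%:R (S :&: T)).
    case: (boolP (in_window m w k%:R (S :&: T))) => winU /=.
      rewrite add0r; apply: (@window_collision_le R _ n k m w tau theta eta) => //.
      1-3: by rewrite card_ord ?k0.
    under eq_bigr do rewrite mulr1.
    by rewrite muB1 lerDl expR_ge0.
  rewrite big_split /= -mulr_suml bern_sum1 mul1r /delta mulrDl mul1r lerD //.
    apply: le_trans (bern_concentration _ m01 _) _; first by rewrite mulr_gt0.
    rewrite cS le_eqVlt; apply/orP; left; apply/eqP; field.
    by rewrite !gt_eqF.
  rewrite expRN lef_pV2 ?posrE ?expR_gt0 //.
  by apply: le_trans (expR_ge1Dx _); rewrite lerDr.
have C0 : 0 < 'C(p, k)%:R :> R by rewrite ltr0n bin_gt0.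
(* After exchanging the sums, the mean number of bad [S] is at most ['C(p, k) * delta], so some mask
   and rows achieve this. *)
have [[T B] TB] : exists x,
    \sum_(S : {set 'I_p} | #|S| == k) (bad x S)%:R <= 'C(p, k)%:R * delta.
  apply: (ex_le_mean mu0 mu1).
  under eq_bigr do rewrite mulr_sumr.
  rewrite exchange_big -sum_ksets_const /=.
  by apply: ler_sum => S cS; apply: bad_le.
(* The default output is also a [k]-set, so that the estimate always has size [k]. *)
have [|A0 _ cA0] := @ex_superset_card 'I_p finset.set0 k.
  by rewrite cards0 card_ord.
pose X0 := masked_design T B.
exists (dirac_fdist R X0).
exists (fun X Y => dirac_fdist R (mask_decoder k m w A0 T X Y)); split.
  move=> X Y A /=; case: eqP => [-> _|_]; last by rewrite ltxx.
  by rewrite /mask_decoder; case: pickP => [A' /andP[/eqP]|].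
rewrite gt_prob_dirac -mulr_sumr ler_pdivlMl // mulrBr mulr1.
rewrite -[X in X - _]mulr1 -sum_ksets_const.
apply: (@le_trans _ _ (\sum_(S : {set 'I_p} | #|S| == k)
    (1 - (bad (T, B) S)%:R))).
  by rewrite sumrB lerD2l lerN2.
apply: ler_sum => S /eqP cS.
case: (boolP (bad (T, B) S)) => [_|]; first by rewrite subrr.
rewrite /bad /= negb_or negbK => /andP[winU]; rewrite winU /= => noV.
by rewrite (@mask_decoderP R n p k alpha m w tau A0 T S _ B) // subr0.
Qed.

(** * Choice of the constants and passage to the limit *)

Local Open Scope classical_set_scope.
Local Open Scope ring_scope.

Theorem theorem1 (R : realType) (alpha eta : R) (k n : nat -> nat)
    (halpha : 0 < alpha < 1) (heta : 0 < eta)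
    (hkp : forall p : nat, (k p <= p)%N)
    (hkoo : k p @[p --> \oo] --> \oo)
    (hko : (fun p : nat => (k p)%:R : R) =o_\oo (fun p : nat => p%:R : R))
    (hn : forall p : nat,
      (1 + eta) * (1 - alpha) * log2 ('C(p, k p)%:R) <= (n p)%:R) :
  exists (D : forall p : nat, design R (n p) p)
         (dec : forall p : nat, decoder R (n p) p),
    (forall (p : nat) (X : 'M[bool]_(n p, p)) (Y : 'cV[bool]_(n p))
            (A : {set 'I_p}), 0 < dec p X Y A -> #|A| = k p) /\
    gt_prob (k p) (D p) (dec p)
      (fun S A => (maxn #|A :\: S| #|S :\: A|)%:R <= alpha * (k p)%:R)
      @[p --> \oo] --> (1 : R).
Proof.
have [a0 a1] := andP halpha.
have a10 : 0 < 1 - alpha by rewrite subr_gt0.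
(* [theta] and [tau] are chosen so that [key] holds and [m + w <= 1]. *)
pose theta := eta / (8 * (1 + eta)).
have eta8 : 0 < 8 * (1 + eta) by lra.
have th0 : 0 < theta by rewrite divr_gt0.
have th1 : theta <= 1 by rewrite ler_pdivrMr //; lra.
pose tau := Num.min (alpha / 2) (3 * eta / 8 * (1 - alpha) / (2 + eta)).
have tau0 : 0 < tau.
  by rewrite lt_min !(divr_gt0, mulr_gt0) //; lra.
have tau1 : tau <= alpha / 2 by rewrite ge_min lexx.
have tau2 : tau * (2 + eta) <= 3 * eta / 8 * (1 - alpha).
  rewrite -ler_pdivlMr; last by lra.
  by rewrite ge_min lexx orbT.
pose w := theta * tau / 4.
have w0 : 0 < w by rewrite divr_gt0 // mulr_gt0.
have w4 : 4 * w <= theta * tau by rewrite mulrC divfK.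
have w4' : 4 * w <= tau.
  by apply: le_trans w4 _; rewrite ler_piMl // ltW.
(* The error budget is spent exactly: [1 - m + w + tau = alpha]. *)
pose m := 1 - alpha + w + tau.
(* The slack between [1 + 7 eta / 8] and [1 + eta / 2] is [3 eta / 8]; the second bound in [tau]
   lets it absorb [(1 + eta / 2) * 2 tau]. *)
have key : (1 + eta / 2) * (m + w) <= (1 - theta) * (1 + eta) * (1 - alpha).
  have -> : (1 - theta) * (1 + eta) = 1 + 7 * eta / 8.
    rewrite /theta; field.
    by rewrite gt_eqF //; lra.
  have : (1 + eta / 2) * (m + w) <= (1 + eta / 2) * (1 - alpha + 2 * tau).
    by rewrite ler_pM2l /m; lra.
  by lra.
(* The probability bound is required only once [k] is positive and [p / k] is large; for other [p] a
   constant [k]-set is output, so the cardinality is right for every [p]. *)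
pose good p (x : design R (n p) p * decoder R (n p) p) :=
  (forall X Y A, 0 < x.2 X Y A -> #|A| = k p) /\
  ((0 < k p)%N -> 12 <= eta * tau * ln (p%:R / (k p)%:R) ->
   1 - ((w ^+ 2)^-1 + 1) / (k p)%:R <=
     gt_prob (k p) x.1 x.2
       (fun S A => (maxn #|A :\: S| #|S :\: A|)%:R <= alpha * (k p)%:R)).
have ex_good p : exists x, @good p x.
  have [[k0 hL]|none] := pselect
      ((0 < k p)%N /\ 12 <= eta * tau * ln (p%:R / (k p)%:R)); last first.
    have [|A0 _ cA0] := @ex_superset_card 'I_p finset.set0 (k p).
      by rewrite cards0 card_ord /=.
    exists (dirac_fdist R (const_mx true), fun _ _ => dirac_fdist R A0).
    split=> [X Y A /=|k0 hL]; last by case: none.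
    by case: eqP => [-> //|_]; rewrite ltxx.
  have kr0 : 0 < (k p)%:R :> R by rewrite ltr0n.
  have p0 : 0 < p%:R :> R by rewrite ltr0n (leq_trans k0).
  have ln20 : 0 < ln 2 :> R by rewrite ln_gt0 // ltr1n.
  have [||||||||||D [dec [cA le_prob]]] :=
    @ex_mask_design R (n p) p (k p) alpha m w tau theta eta.
  - by rewrite k0 hkp.
  - by [].
  - by rewrite /m; lra.
  - by rewrite /m; lra.
  - by rewrite th0.
  - by [].
  - by [].
  - by rewrite /m; lra.
  - set L := ln _; have L0 : 0 <= L.
      by rewrite ln_ge0 // ler_pdivlMr // mul1r ler_nat.
    (* This bound turns the assumption on [n], stated with ['C(p, k)], into one in terms of
       [k ln (p / k)]. *)
    have binL : (k p)%:R * L <= ln 'C(p, k p)%:R.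
      rewrite mulr_natl -lnXn ?divr_gt0 // ler_ln ?posrE ?ltr0n ?bin_gt0 //.
        exact: expr_divn_le_bin.
      by rewrite exprn_gt0 // divr_gt0.
    have nL : (1 + eta) * (1 - alpha) * ln 'C(p, k p)%:R <= (n p)%:R * ln 2.
      by rewrite -ler_pdivrMr // -[leLHS]mulrA; exact: hn.
    have th1' : 0 <= 1 - theta by rewrite subr_ge0.
    apply: (@le_trans _ _
        ((1 - theta) * (1 + eta) * (1 - alpha) * ((k p)%:R * L))).
      by rewrite -[leLHS]mulrA ler_wpM2r // mulr_ge0.
    rewrite -[leRHS]mulrA; apply: le_trans (ler_wpM2l th1' nL).
    have eta1 : 0 <= 1 + eta by lra.
    by rewrite -!mulrA !ler_wpM2l // ltW.
  - by [].
  by exists (D, dec); split.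
have [x goodx] : exists x : forall p, design R (n p) p * decoder R (n p) p,
    forall p, good p (x p).
  by exists (fun p => projT1 (cid (ex_good p))) => p; exact: projT2 (cid _).
exists (fun p => (x p).1), (fun p => (x p).2); split.
  by move=> p; exact: (goodx p).1.
apply/cvgrPdist_le => e e0.
have etau0 : 0 < eta * tau by rewrite mulr_gt0.
(* [k <= c p] is equivalent to [ln (p / k) >= 12 / (eta tau)] for positive [k] and [p]. *)
pose c := expR (- (12 / (eta * tau))).
have c0 : 0 < c by rewrite expR_gt0.
have near_ko := (eqoP _ _ _).1 hko c c0.
(* Beyond this threshold on [k] the failure bound is at most [e]. *)
have near_k := (cvgnyPge _).1 hkoo (Num.truncn (((w ^+ 2)^-1 + 1) / e)).+1.
near=> p.
have kC : (Num.truncn (((w ^+ 2)^-1 + 1) / e) < k p)%N by near: p; exact: near_k.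
have k0 : (0 < k p)%N by apply: leq_ltn_trans kC.
have kr0 : 0 < (k p)%:R :> R by rewrite ltr0n.
have kp : (k p)%:R <= c * p%:R :> R.
  have : `|(k p)%:R : R| <= c * `|p%:R : R| by near: p; exact: near_ko.
  by rewrite !normr_nat.
have p0 : 0 < p%:R :> R by rewrite ltr0n (leq_trans k0).
have [_ le_prob] := goodx p.
rewrite ger0_norm ?subr_ge0 ?gt_prob_le1 // lerBlDl -lerBlDr.
apply: le_trans (le_prob k0 _).
  rewrite lerD2l lerN2 ler_pdivrMr // mulrC -ler_pdivrMr //.
  by apply: ltW; apply: lt_le_trans (truncnS_gt _) _; rewrite ler_nat.
rewrite mulrC -ler_pdivrMr // -[leLHS]expRK ler_ln ?posrE ?expR_gt0 ?divr_gt0 //.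
rewrite ler_pdivlMr // -ler_pdivlMl ?expR_gt0 // -expRN.
by rewrite -/c.
Unshelve. all: by end_near.
Qed.
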